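(* Let $1\le m_0\le K$ be an integer. Assume that for each $k\in[K]$ and $(i,i')\in\{(0,1),(1,0)\}$, $\int\log(f_i^k/f_{i'}^k)f_i^k\,d\mu^k>0$ and $\int[\log(f_i^k/f_{i'}^k)]^2f_i^k\,d\mu^k<\infty$. For each $\alpha\in(0,1)$ let $b_\alpha=|\log\alpha|+\log\binom{K}{m_0}$. Then the Sum-Intersection rule $\{\delta_S(b_\alpha)\}$ is second-order asymptotically optimal in $\{\Delta_{m_0}^{\mathrm{gmr}}(\alpha)\}$ as $\alpha\to0$, that is, for each $A\subset[K]$, $$\limsup_{\alpha\to0}\Bigl(\mathbb E_A[T_S(b_\alpha)]-T_A^{\min}\bigl(\Delta_{m_0}^{\mathrm{gmr}}(\alpha)\bigr)\Bigr)<\infty.$$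
   Context: $K\ge2$, $[K]=\{1,\dots,K\}$. For each $k\in[K]$, $\mu^k$ is a $\sigma$-finite measure on a measurable space $\mathcal X^k$ and $f_0^k,f_1^k$ are probability densities with respect to $\mu^k$. One observes $K$ independent streams $\{\mathbf X_t^k:t\ge1\}$, each i.i.d. For $A\subset[K]$, $\mathbb P_A$ (expectation $\mathbb E_A$) is the law under which the streams are independent and stream $k$ is i.i.d. with density $f_1^k$ if $k\in A$ and $f_0^k$ if $k\notin A$. $\mathcal F_t$ is the $\sigma$-field generated by all observations from all streams up to time $t$. Here the collection of possible signal subsets is $\mathcal A=2^{[K]}$. A sequential procedure is a pair $(T,D)$ with $T$ an $\{\mathcal F_t\}_{t\ge1}$-stopping time and $D$ an $\mathcal F_T$-measurable decision with values in $\mathcal A$ (the set of streams declared signals); $\Delta$ is the class of all such procedures. For $\Delta'\subset\Delta$, $T_A^{\min}(\Delta')=\inf_{(T,D)\in\Delta'}\mathbb E_A[T]$. The class controlling the generalized misclassification rate is $$\Delta_{m_0}^{\mathrm{gmr}}(\alpha)=\Bigl\{(T,D)\in\Delta:\max_{A\subset[K]}\mathbb P_A(|D\triangle A|\ge m_0)\le\alpha\Bigr\}.$$ Log-likelihood ratios: $\lambda_t^k=\sum_{s=1}^t\log\frac{f_1^k(\mathbf X_s^k)}{f_0^k(\mathbf X_s^k)}$. Let $\tilde\lambda_t^{(1)}\le\cdots\le\tilde\lambda_t^{(K)}$ be the order statistics of $\{|\lambda_t^k|:k\in[K]\}$. The Sum-Intersection rule $\delta_S(b)=(T_S(b),D_S(b))$,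 $b>0$, is $$T_S(b)=\min\Bigl\{t\ge1:\sum_{i=1}^{m_0}\tilde\lambda_t^{(i)}\ge b\Bigr\},\qquad D_S(b)=\{k\in[K]:\lambda_{T_S(b)}^k>0\}.$$ It is known from earlier work that $\delta_S(b_\alpha)\in\Delta_{m_0}^{\mathrm{gmr}}(\alpha)$ for the threshold $b_\alpha$ in the claim. *)

(* Defs.v *)
From HB Require Import structures.
From mathcomp Require Import all_boot all_order all_algebra.
From mathcomp Require Import all_classical all_reals all_analysis.

Set Implicit Arguments.
Unset Strict Implicit.
Unset Printing Implicit Defensive.

Import Order.TTheory GRing.Theory Num.Theory.
Import numFieldNormedType.Exports.

Local Open Scope classical_set_scope.
Local Open Scope ring_scope.
Local Open Scope ereal_scope.

Definition is_density (R : realType) (d : measure_display)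
    (X : measurableType d) (mu : {measure set X -> \bar R}) (g : X -> R) : Prop :=
  [/\ measurable_fun setT g, forall x, (0 <= g x)%R &
      \int[mu]_x (g x)%:E = 1].

(* The quotient and the logarithm are the extended-real ones: log (c / 0) = +oo
   for c > 0 and log 0 = -oo.  Where g = 0 the value is irrelevant in the
   information integrals below, by the convention 0 * (+-oo) = 0. *)
Definition llr (R : realType) (X : Type) (g h : X -> R) (x : X) : \bar R :=
  lne ((g x)%:E / (h x)%:E).

Definition llr_mean (R : realType) (d : measure_display) (X : measurableType d)
    (mu : {measure set X -> \bar R}) (g h : X -> R) : \bar R :=
  \int[mu]_x (llr g h x * (g x)%:E).

Definition llr_second_moment (R : realType) (d : measure_display)
    (X : measurableType d) (mu : {measure set X -> \bar R}) (g h : X -> R) :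
    \bar R :=
  \int[mu]_x ((llr g h x) ^+ 2 * (g x)%:E).

Definition mutually_independent (R : realType) (K : nat)
    (d : 'I_K -> measure_display) (X : forall k, measurableType (d k))
    (d' : measure_display) (Omega : measurableType d') (P : probability Omega R)
    (obs : forall k : 'I_K, nat -> Omega -> X k) : Prop :=
  forall (J : seq ('I_K * nat)) (B : forall k : 'I_K, nat -> set (X k)),
    uniq J -> (forall k s, measurable (B k s)) ->
    P (\bigcap_(i in [set` J]) (obs i.1 i.2 @^-1` B i.1 i.2)) =
    \prod_(i <- J) P (obs i.1 i.2 @^-1` B i.1 i.2).

(* obs k s is the (s+1)-th observation of stream k, so that the first t
   observations are those with s < t.  f k true is the density of stream k when
   k is a signal, f k false its density when k is not. *)
Definition stream_model (R : realType) (K : nat)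
    (d : 'I_K -> measure_display) (X : forall k, measurableType (d k))
    (mu : forall k, {sigma_finite_measure set (X k) -> \bar R})
    (f : forall k : 'I_K, bool -> X k -> R)
    (d' : measure_display) (Omega : measurableType d')
    (P : {set 'I_K} -> probability Omega R)
    (obs : forall k : 'I_K, nat -> Omega -> X k) : Prop :=
  [/\ forall k s, measurable_fun setT (obs k s),
      forall A k s (B : set (X k)), measurable B ->
        P A (obs k s @^-1` B) = \int[mu k]_(x in B) (f k (k \in A) x)%:E &
      forall A, mutually_independent (P A) obs].

Definition history (K : nat)
    (d : 'I_K -> measure_display) (X : forall k, measurableType (d k))
    (Omega : Type) (obs : forall k : 'I_K, nat -> Omega -> X k) (t : nat) :
    set (set Omega) :=
  <<s [set E | exists (k : 'I_K) (s : nat) (B : set (X k)),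
         [/\ (s < t)%N, measurable B & E = obs k s @^-1` B]] >>.

Definition full_history (K : nat)
    (d : 'I_K -> measure_display) (X : forall k, measurableType (d k))
    (Omega : Type) (obs : forall k : 'I_K, nat -> Omega -> X k) :
    set (set Omega) :=
  <<s [set E | exists (k : 'I_K) (s : nat) (B : set (X k)),
         measurable B /\ E = obs k s @^-1` B] >>.

(* Stopping times take values in {1, 2, ...} together with +oo. *)
Definition stopping_time (R : realType) (K : nat)
    (d : 'I_K -> measure_display) (X : forall k, measurableType (d k))
    (Omega : Type) (obs : forall k : 'I_K, nat -> Omega -> X k)
    (T : Omega -> \bar R) : Prop :=
  (forall w, T w = +oo \/ exists2 t : nat, (1 <= t)%N & T w = t%:R%:E) /\
  (forall t : nat, (1 <= t)%N -> history obs t [set w | T w <= t%:R%:E]).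

Definition stopped_history (R : realType) (K : nat)
    (d : 'I_K -> measure_display) (X : forall k, measurableType (d k))
    (Omega : Type) (obs : forall k : 'I_K, nat -> Omega -> X k)
    (T : Omega -> \bar R) : set (set Omega) :=
  [set E | full_history obs E /\
     forall t : nat, (1 <= t)%N -> history obs t (E `&` [set w | T w <= t%:R%:E])].

Definition procedure (R : realType) (K : nat) (Omega : Type) : Type :=
  ((Omega -> \bar R) * (Omega -> {set 'I_K}))%type.

Definition sequential_procedures (R : realType) (K : nat)
    (d : 'I_K -> measure_display) (X : forall k, measurableType (d k))
    (Omega : Type) (obs : forall k : 'I_K, nat -> Omega -> X k) :
    set (procedure R K Omega) :=
  [set delta | stopping_time obs delta.1 /\
     forall B : {set 'I_K},
       stopped_history obs delta.1 [set w | delta.2 w = B]].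

Definition symdiff (T : finType) (A B : {set T}) : {set T} :=
  (A :\: B) :|: (B :\: A).

Definition gmr_class (R : realType) (K : nat)
    (d : 'I_K -> measure_display) (X : forall k, measurableType (d k))
    (d' : measure_display) (Omega : measurableType d')
    (P : {set 'I_K} -> probability Omega R)
    (obs : forall k : 'I_K, nat -> Omega -> X k) (m0 : nat) (alpha : R) :
    set (procedure R K Omega) :=
  [set delta | sequential_procedures obs delta /\
     forall A : {set 'I_K},
       P A [set w | (m0 <= #|symdiff (delta.2 w) A|)%N] <= alpha%:E].

Definition min_expected_time (R : realType) (K : nat)
    (d' : measure_display) (Omega : measurableType d')
    (P : probability Omega R) (Delta : set (procedure R K Omega)) : \bar R :=
  ereal_inf [set \int[P]_w delta.1 w | delta in Delta].

Definition loglik (R : realType) (K : nat)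
    (d : 'I_K -> measure_display) (X : forall k, measurableType (d k))
    (f : forall k : 'I_K, bool -> X k -> R)
    (Omega : Type) (obs : forall k : 'I_K, nat -> Omega -> X k)
    (k : 'I_K) (t : nat) (w : Omega) : \bar R :=
  \sum_(s < t) llr (f k true) (f k false) (obs k s w).

(* order_stat a i is the (i+1)-th smallest of the K values of a. *)
Definition order_stat (R : realType) (K : nat) (a : 'I_K -> \bar R) (i : nat) :
    \bar R :=
  nth 0 (sort <=%O [seq a k | k <- enum 'I_K]) i.

Definition SI_statistic (R : realType) (K : nat)
    (d : 'I_K -> measure_display) (X : forall k, measurableType (d k))
    (f : forall k : 'I_K, bool -> X k -> R)
    (Omega : Type) (obs : forall k : 'I_K, nat -> Omega -> X k)
    (m0 : nat) (t : nat) (w : Omega) : \bar R :=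
  \sum_(i < m0) order_stat (fun k => `|loglik f obs k t w|) i.

(* The infimum is over a set of positive integers, hence a minimum when that
   set is nonempty; it is +oo otherwise. *)
Definition SI_time (R : realType) (K : nat)
    (d : 'I_K -> measure_display) (X : forall k, measurableType (d k))
    (f : forall k : 'I_K, bool -> X k -> R)
    (Omega : Type) (obs : forall k : 'I_K, nat -> Omega -> X k)
    (m0 : nat) (b : R) (w : Omega) : \bar R :=
  ereal_inf [set t%:R%:E | t in
    [set t : nat | (1 <= t)%N /\ b%:E <= SI_statistic f obs m0 t w]].

(* On the event that the rule never stops, the decision is the empty set. *)
Definition SI_decision (R : realType) (K : nat)
    (d : 'I_K -> measure_display) (X : forall k, measurableType (d k))
    (f : forall k : 'I_K, bool -> X k -> R)
    (Omega : Type) (obs : forall k : 'I_K, nat -> Omega -> X k)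
    (m0 : nat) (b : R) (w : Omega) : {set 'I_K} :=
  [set k : 'I_K | `[< exists2 t : nat, SI_time f obs m0 b w = t%:R%:E &
                        0 < loglik f obs k t w >]]%SET.

Definition sum_intersection (R : realType) (K : nat)
    (d : 'I_K -> measure_display) (X : forall k, measurableType (d k))
    (f : forall k : 'I_K, bool -> X k -> R)
    (Omega : Type) (obs : forall k : 'I_K, nat -> Omega -> X k)
    (m0 : nat) (b : R) : procedure R K Omega :=
  (SI_time f obs m0 b, SI_decision f obs m0 b).

Definition SI_threshold (R : realType) (K m0 : nat) (alpha : R) : R :=
  (`|ln alpha| + ln ('C(K, m0)%:R))%R.

(* The difference uses the dual subtraction, for which +oo - (+oo) = +oo, so
   that a finite limsup does force the expected time of the rule to be finite
   for all small alpha. *)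
Definition second_order_optimal (R : realType) (K : nat)
    (d' : measure_display) (Omega : measurableType d')
    (P : {set 'I_K} -> probability Omega R)
    (delta : R -> procedure R K Omega)
    (Delta : R -> set (procedure R K Omega)) : Prop :=
  forall A : {set 'I_K},
    limf_esup (fun alpha : R =>
      ((\int[P A]_w (delta alpha).1 w)%E
       - min_expected_time (P A) (Delta alpha))%dE : \bar R)
      0%R^'+ < +oo.

(* Main.v *)
Require Import Defs.
From HB Require Import structures.
From mathcomp Require Import all_boot all_order all_algebra.
From mathcomp Require Import all_classical all_reals all_analysis.
From mathcomp Require Import measurable_realfun ring lra.

Set Implicit Arguments.
Unset Strict Implicit.
Unset Printing Implicit Defensive.

Import Order.TTheory GRing.Theory Num.Theory.
Import numFieldNormedType.Exports.

Local Open Scope classical_set_scope.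
Local Open Scope ring_scope.
Local Open Scope ereal_scope.

(** Fix the true signal set A and orient each log-likelihood ratio towards the
    true state of its stream.  Under P_A this gives random walks xi^k with
    positive drift, and exp (- xi^k) is the likelihood ratio of the false state
    of stream k against the true one.  The time T_S of the rule is compared
    with the stopping time T of an arbitrary procedure of the class: the
    expectation under P_A of the positive part of T_S - T is bounded uniformly
    in alpha.

    Chernoff step.  If the rule has not stopped at time s, then the absolute
    values of the log-likelihood ratios sum to less than b over some set M of
    m0 streams, so that
      exp (b / 2) * prod_(k in M) exp (- xi^k_s / 2) >= 1
    (SI_statistic_lt).  Hence T_S - T is at most the sum of the left-hand sides
    over all such M and all times s >= T (SI_time_le_series).  Given the past
    at time t, the factors contributed by n further observations have mean
    rho_M ^ n, where rho_M is the product over M of the Hellinger affinities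
    int sqrt (f_0 f_1) d mu.  A positive Kullback-Leibler information forces
    the two densities to differ, which makes rho_M < 1 (hellinger_lt1).  The
    sum over n is thus a geometric series, and it remains to bound
    exp (b / 2) * E_A [prod_(k in M) exp (- xi^k_T / 2)].

    Change of measure step.  On the event that the procedure declares the set
    B, let F be the set of the streams of M whose state B declares correctly.
    The inequality 2 u v <= u^2 + v^2 gives (root_lr_split)
      exp (b / 2) * prod_M exp (- xi / 2)
        <= 1/2 * (exp b * prod_F exp (- xi) + prod_(M minus F) exp (- xi)),
    and the two products are the likelihood ratios against P_A of the laws
    whose signal sets differ from A exactly on F and exactly on M minus F
    (change_of_measure, integral_lr_prod_le).  Integrated, they become
    probabilities of declaring B.  Under the first law this declaration is
    wrong on every stream of M (decision_error_subset), so its probability is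
    at most alpha; the second is at most 1.  As exp b * alpha is the binomial
    coefficient for b = b_alpha, the total is bounded in alpha
    (expected_SI_time_le).

    The same inequality, applied to the procedure that stops after one
    observation, shows that the expectation of T_S is finite. *)

(** * Integration *)

Section integration.
Import HBNNSimple.

(** Only the positive part of f matters, and its integral is the supremum over
    the simple functions below it, each of which lies below g. *)
Lemma le_integral_upper d (T : measurableType d) (R : realType)
    (mu : {measure set T -> \bar R}) (f g : T -> \bar R) :
  (forall x, 0 <= g x) -> (forall x, f x <= g x) ->
  \int[mu]_x f x <= \int[mu]_x g x.
Proof.
move=> g0 fg.
apply: (@le_trans _ _ (\int[mu]_x f^\+ x)).
  rewrite integralE -[leRHS]sube0; apply: leeB => //.
  exact: integral_ge0.
rewrite !ge0_integralTE //.
apply: ereal_sup_le => _ [h /= hf <-].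
exists h => // x; apply: (le_trans (hf x)).
by rewrite funeposE ge_max fg g0.
Qed.

(** The measure with density h, transported by Z, is determined by its values
    on measurable sets, and so are the integrals against it.  With Z1 an
    observation and Z2 the identity this rewrites an expectation as an integral
    against a density; with h2 constant it peels an independent factor off a
    product. *)
Lemma integral_comp_determined d1 d2 d3 (T1 : measurableType d1)
    (T2 : measurableType d2) (X : measurableType d3) (R : realType)
    (m1 : {measure set T1 -> \bar R}) (m2 : {measure set T2 -> \bar R})
    (Z1 : T1 -> X) (Z2 : T2 -> X) (h1 : T1 -> R) (h2 : T2 -> R) :
  measurable_fun setT Z1 -> measurable_fun setT Z2 ->
  measurable_fun setT h1 -> measurable_fun setT h2 ->
  (forall x, (0 <= h1 x)%R) -> (forall x, (0 <= h2 x)%R) ->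
  (forall B, measurable B ->
     \int[m1]_x (\1_B (Z1 x) * h1 x)%:E = \int[m2]_x (\1_B (Z2 x) * h2 x)%:E) ->
  forall g : X -> R, measurable_fun setT g -> (forall x, (0 <= g x)%R) ->
  \int[m1]_x (g (Z1 x) * h1 x)%:E = \int[m2]_x (g (Z2 x) * h2 x)%:E.
Proof.
move=> mZ1 mZ2 mh1 mh2 h10 h20 HB g mg g0.
have mEg : measurable_fun setT (EFin \o g) by exact/measurable_EFinP.
pose s := nnsfun_approx measurableT mEg.
have key d' (T : measurableType d') (m : {measure set T -> \bar R})
    (Z : T -> X) (h : T -> R) : measurable_fun setT Z -> measurable_fun setT h ->
    (forall x, (0 <= h x)%R) ->
  \int[m]_x (g (Z x) * h x)%:E = limn (fun n =>
     \sum_(y \in range (s n)) y%:E *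
        \int[m]_x (\1_(s n @^-1` [set y]) (Z x) * h x)%:E).
  move=> mZ mh h0.
  transitivity (limn (fun n => \int[m]_x (s n (Z x) * h x)%:E)).
    rewrite -monotone_convergence //=.
    - apply: eq_integral => x _; apply/esym/cvg_lim => //.
      rewrite EFinM; under eq_fun do rewrite EFinM.
      apply: cvgeZr => //.
      by apply: (@cvg_nnsfun_approx _ _ _ _ measurableT _ mEg) => // y _; rewrite lee_fin.
    - move=> n; apply/measurable_EFinP; apply: measurable_funM => //.
      by apply: measurableT_comp.
    - by move=> n x _; rewrite lee_fin mulr_ge0.
    - move=> x _ a b ab; rewrite lee_fin ler_wpM2r//.
      exact/lefP/nd_nnsfun_approx.
  congr (limn _); apply/funext => n.
  transitivity (\int[m]_x (\sum_(y \in range (s n))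
      (y * (\1_(s n @^-1` [set y]) (Z x) * h x))%:E)).
    apply: eq_integral => x _.
    rewrite fimfunE fsumEFin//; congr EFin.
    rewrite !fsbig_finite//= big_distrl /=.
    by apply: eq_bigr => y _; rewrite mulrA.
  have mi y : measurable_fun setT (fun x : T => (\1_(s n @^-1` [set y]) (Z x) * h x)%:E).
    apply/measurable_EFinP/measurable_funM => //.
    exact: measurableT_comp.
  rewrite ge0_integral_fsum//; last 2 first.
  - move=> y; under eq_fun do rewrite EFinM.
    exact: measurable_funeM.
  - move=> y x _; rewrite lee_fin mulrA mulr_ge0// -lee_fin.
    exact: (@nnfun_muleindic_ge0 _ _ _ (s n)).
  apply: eq_fsbigr => y; rewrite inE => -[x _ <-].
  under eq_integral do rewrite EFinM.
  rewrite ge0_integralZl_EFin//.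
  by move=> z _; rewrite lee_fin mulr_ge0.
rewrite key// key//; congr (limn _); apply/funext => n.
apply: eq_fsbigr => y _; rewrite HB//.
Qed.

End integration.

Lemma weighted_measure d (T : measurableType d) (R : realType)
    (m : {measure set T -> \bar R}) (h : T -> R) :
  measurable_fun setT h -> (forall x, (0 <= h x)%R) ->
  exists nu : {measure set T -> \bar R}, forall E, nu E = \int[m]_(x in E) (h x)%:E.
Proof.
move=> mh h0.
pose nu := fun E : set T => \int[m]_(x in E) (h x)%:E.
have nu0 : nu set0 = 0 by rewrite /nu integral_set0.
have nu_ge0 E : 0 <= nu E by apply: integral_ge0 => x _; rewrite lee_fin.
have nus : semi_sigma_additive nu.
  move=> /= F mF tF mUF; rewrite /nu; apply: cvg_toP.
    apply: ereal_nondecreasing_is_cvgn => i j ij.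
    by apply: lee_sum_nneg_natr => // k _ _; exact: nu_ge0.
  rewrite ge0_integral_bigcup//=.
  - by apply/measurable_EFinP/measurable_funTS.
  - by move=> x _; rewrite lee_fin.
pose M := isMeasure.Build _ _ _ nu nu0 nu_ge0 nus.
pose nu' : {measure set T -> \bar R} := HB.pack nu M.
by exists nu'.
Qed.

(** Uniqueness of measures on a generating pi-system, read for measures given by
    densities with respect to two different base measures. *)
Lemma eq_integral_pi_system d (T : measurableType d) (R : realType)
    (m1 m2 : {measure set T -> \bar R}) (h1 h2 : T -> R) (G : set (set T)) :
  measurable_fun setT h1 -> measurable_fun setT h2 ->
  (forall x, (0 <= h1 x)%R) -> (forall x, (0 <= h2 x)%R) ->
  G `<=` measurable -> setI_closed G -> G setT ->
  \int[m1]_x (h1 x)%:E < +oo ->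
  (forall E, G E -> \int[m1]_(x in E) (h1 x)%:E = \int[m2]_(x in E) (h2 x)%:E) ->
  forall E, <<s G >> E ->
    \int[m1]_(x in E) (h1 x)%:E = \int[m2]_(x in E) (h2 x)%:E.
Proof.
move=> mh1 mh2 h10 h20 Gm GI GT fin GE E sE.
have [nu1 nu1E] := weighted_measure m1 mh1 h10.
have [nu2 nu2E] := weighted_measure m2 mh2 h20.
rewrite -nu1E -nu2E.
apply: (@g_sigma_algebra_measure_unique _ _ _ G Gm (fun=> setT)) => //.
- by rewrite bigcup_const.
- by move=> A GA; rewrite nu1E nu2E GE.
- by move=> _; rewrite nu1E.
Qed.

(** * Expectation of a product of independent factors *)

Section independence.
Context (R : realType) (K : nat) (d : 'I_K -> measure_display)
  (X : forall k, measurableType (d k)) (d' : measure_display)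
  (Omega : measurableType d') (Pr : probability Omega R)
  (obs : forall k : 'I_K, nat -> Omega -> X k).
Hypothesis mobs : forall k s, measurable_fun setT (obs k s).
Hypothesis indep : mutually_independent Pr obs.
Implicit Types (J : seq ('I_K * nat)) (B : forall k : 'I_K, nat -> set (X k))
  (g : forall k : 'I_K, nat -> X k -> R).

(** The index k of a stream determines the type of its observations, so the set
    at one index is replaced through a dependent update. *)
Definition upd_sets (B : forall k : 'I_K, nat -> set (X k)) (i : 'I_K * nat)
    (C : set (X i.1)) (k : 'I_K) (s : nat) : set (X k) :=
  if s == i.2 then dfwith (fun k' => B k' s) i.1 C k else B k s.

Arguments upd_sets B {i} C k s.

Lemma upd_sets_in B i (C : set (X i.1)) : upd_sets B C i.1 i.2 = C.
Proof. by rewrite /upd_sets eqxx dfwithin. Qed.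

Lemma upd_sets_out B i (C : set (X i.1)) j :
  j != i -> upd_sets B C j.1 j.2 = B j.1 j.2.
Proof.
move: i C j => [k s] C [k' s'] /= ne; rewrite /upd_sets; case: eqP => // ss.
rewrite dfwithout//=; apply: contraNneq ne => kk.
by apply/eqP; rewrite /= in ss; rewrite ss kk.
Qed.

Lemma measurable_upd_sets B i (C : set (X i.1)) :
  (forall k s, measurable (B k s)) -> measurable C ->
  forall k s, measurable (upd_sets B C k s).
Proof.
move=> mB mC k s; have [ksi|/(upd_sets_out B C)->] // := eqVneq (k, s) i.
by rewrite -[k]/(k, s).1 -[s]/(k, s).2 ksi upd_sets_in.
Qed.

Lemma measurable_prod_obs g J : (forall k s, measurable_fun setT (g k s)) ->
  measurable_fun setT (fun w => \prod_(i <- J) g i.1 i.2 (obs i.1 i.2 w))%R.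
Proof.
move=> mg; apply: measurable_prod => i _.
exact: measurableT_comp.
Qed.

Lemma prod_indic_preimage B J w :
  (\prod_(i <- J) \1_(B i.1 i.2) (obs i.1 i.2 w) =
   \1_(\bigcap_(i in [set` J]) (obs i.1 i.2 @^-1` B i.1 i.2)) w :> R)%R.
Proof.
rewrite indicE; have [h|/negP] := boolP (w \in _).
  move/set_mem: h => h; rewrite big_seq big1// => i iJ.
  by rewrite indicE mem_set//; exact: h.
rewrite inE => /existsNP[i /not_implyP[iJ niB]].
rewrite (big_rem i)//= indicE memNset ?mul0r//.
Qed.

(** Independence is given for events.  By induction on J1, one factor at a time
    passes from an indicator to an arbitrary function g: when the function at i
    is an indicator the claim is an instance of the induction hypothesis, with
    i moved to J2, and integral_comp_determined then extends it to any
    function. *)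
Lemma expectation_prod_mixed g (c : 'I_K -> nat -> R) :
  (forall k s, measurable_fun setT (g k s)) ->
  (forall k s x, (0 <= g k s x)%R) ->
  (forall k s, \int[Pr]_w (g k s (obs k s w))%:E = (c k s)%:E) ->
  forall J1 J2 B, (forall k s, measurable (B k s)) -> uniq (J1 ++ J2) ->
  \int[Pr]_w (\prod_(i <- J1) g i.1 i.2 (obs i.1 i.2 w) *
              \prod_(i <- J2) \1_(B i.1 i.2) (obs i.1 i.2 w))%:E =
  (\prod_(i <- J1) c i.1 i.2 *
   \prod_(i <- J2) fine (Pr (obs i.1 i.2 @^-1` B i.1 i.2)))%:E.
Proof.
move=> mg g0 gc.
have mpre k s C : measurable C -> measurable (obs k s @^-1` C).
  by move=> mC; rewrite -[X in measurable X]setTI; exact: mobs.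
elim=> [|i J1 IH] J2 B mB uJ.
  under eq_integral do rewrite big_nil mul1r prod_indic_preimage.
  rewrite integral_indic//=; last first.
    by apply: fin_bigcap_measurable => // i _; exact: mpre.
  rewrite setIT indep// big_nil mul1r.
  elim: (J2) => [|j J IH]; first by rewrite !big_nil.
  rewrite !big_cons IH EFinM fineK//.
  by apply: fin_num_measure; exact: mpre.
have c0 k s : (0 <= c k s)%R.
  by rewrite -lee_fin -gc; apply: integral_ge0 => w _; rewrite lee_fin.
pose h w := (\prod_(i <- J1) g i.1 i.2 (obs i.1 i.2 w) *
              \prod_(i <- J2) \1_(B i.1 i.2) (obs i.1 i.2 w))%R.
pose C := (\prod_(i <- J1) c i.1 i.2 *
   \prod_(i <- J2) fine (Pr (obs i.1 i.2 @^-1` B i.1 i.2)))%R.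
have mh : measurable_fun setT h.
  apply: measurable_funM; first exact: measurable_prod_obs.
  apply: (@measurable_prod_obs (fun k s => \1_(B k s))) => k s.
  exact: measurable_indic.
have h0 w : (0 <= h w)%R.
  by apply: mulr_ge0; apply: prodr_ge0.
have C0 : (0 <= C)%R.
  by apply: mulr_ge0; apply: prodr_ge0 => // j _; exact: fine_ge0.
transitivity (\int[Pr]_w (g i.1 i.2 (obs i.1 i.2 w) * h w)%:E).
  by apply: eq_integral => w _; rewrite big_cons mulrA.
rewrite big_cons -mulrA -/C.
transitivity (\int[Pr]_w (g i.1 i.2 (obs i.1 i.2 w) * C)%:E); last first.
  under eq_integral do rewrite EFinM.
  rewrite ge0_integralZr//.
  - by rewrite gc.
  - by apply/measurable_EFinP; exact: measurableT_comp.
  - by move=> w _; rewrite lee_fin.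
apply: (@integral_comp_determined _ _ _ _ _ _ _ Pr Pr _ _ h (fun=> C)) => //.
move=> B0 mB0.
have iJ : i \notin J1 ++ J2 by move: uJ => /=/andP[].
have E w : (\1_B0 (obs i.1 i.2 w) * h w =
   \prod_(i <- J1) g i.1 i.2 (obs i.1 i.2 w) *
   \prod_(j <- i :: J2) \1_(upd_sets B B0 j.1 j.2) (obs j.1 j.2 w))%R.
  rewrite big_cons upd_sets_in mulrCA; congr (_ * (_ * _))%R.
  apply: eq_big_seq => j jJ; rewrite upd_sets_out//.
  by apply: contraNneq iJ => <-; rewrite mem_cat jJ orbT.
under eq_integral do rewrite E.
rewrite IH; last 2 first.
  - exact: measurable_upd_sets.
  - rewrite (perm_uniq (_ : perm_eq _ (i :: J1 ++ J2)))//.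
    by rewrite -cat1s (perm_catCA J1 [:: i]).
under [RHS]eq_integral do rewrite EFinM.
rewrite ge0_integralZr//; last first.
  by apply/measurable_EFinP; exact: measurableT_comp.
rewrite big_cons upd_sets_in mulrCA EFinM; congr (_ * _).
  rewrite fineK ?fin_num_measure//; last exact: mpre.
  under [RHS]eq_integral do rewrite -[\1_B0 _]/(\1_(obs i.1 i.2 @^-1` B0) _).
  by rewrite integral_indic ?setIT//; exact: mpre.
congr EFin; congr (_ * _)%R.
apply: eq_big_seq => j jJ; rewrite upd_sets_out//.
by apply: contraNneq iJ => <-; rewrite mem_cat jJ orbT.
Qed.

Lemma expectation_prod g (c : 'I_K -> nat -> R) J :
  (forall k s, measurable_fun setT (g k s)) ->
  (forall k s x, (0 <= g k s x)%R) ->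
  (forall k s, \int[Pr]_w (g k s (obs k s w))%:E = (c k s)%:E) -> uniq J ->
  \int[Pr]_w (\prod_(i <- J) g i.1 i.2 (obs i.1 i.2 w))%:E =
  (\prod_(i <- J) c i.1 i.2)%:E.
Proof.
move=> mg g0 gc uJ.
have := expectation_prod_mixed mg g0 gc (J1 := J) (J2 := [::])
  (fun _ _ => measurableT).
rewrite cats0 => /(_ uJ); rewrite big_nil mulr1 => <-.
by apply: eq_integral => w _; rewrite big_nil mulr1.
Qed.

End independence.

(** * Hellinger affinity of two densities *)

Section hellinger.
Context (R : realType) (d : measure_display) (X : measurableType d)
  (mu : {measure set X -> \bar R}) (p q : X -> R).
Hypotheses (dp : is_density mu p) (dq : is_density mu q).

Lemma sqrt_ratioM (a b : R) : (0 <= a)%R -> (0 <= b)%R ->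
  (Num.sqrt (b / a) * a = Num.sqrt a * Num.sqrt b)%R.
Proof.
move=> a0 b0; rewrite sqrtrM// sqrtrV// mulrC mulrCA [RHS]mulrC.
have [->|az] := eqVneq a 0%R; first by rewrite sqrtr0 invr0 !mulr0.
congr (_ * _)%R; rewrite -{1}(sqr_sqrtr a0) expr2 mulfK//.
by rewrite sqrtr_eq0 -ltNge lt_def az.
Qed.

(** Where both densities vanish the log-likelihood ratio is log 0, an infinite
    value which the factor p x = 0 cancels. *)
Lemma llr_diag (x : X) : p x = q x -> (llr p q x * (p x)%:E)%E = 0.
Proof.
case: dp dq => _ p0 _ [_ q0 _] pq.
have [->|pz] := eqVneq (p x) 0%R; first by rewrite mule0.
by rewrite /llr -pq inver (negPf pz) -EFinM divff// lne1 mul0e.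
Qed.

(** The integral of (sqrt p - sqrt q)^2 is twice the gap between 1 and the
    affinity.  If the gap closed, p and q would agree almost everywhere and the
    mean log-likelihood ratio would vanish. *)
Lemma hellinger_lt1 : 0 < llr_mean mu p q ->
  \int[mu]_x (Num.sqrt (q x / p x) * p x)%:E < 1.
Proof.
move=> mean0; rewrite ltNge; apply/negP => rho1.
move: mean0; apply/negP; rewrite -leNgt.
case: dp dq => mp p0 p1 [mq q0 q1].
pose r (x : X) : R := (Num.sqrt (p x) * Num.sqrt (q x))%R.
pose D (x : X) : R := ((Num.sqrt (p x) - Num.sqrt (q x)) ^+ 2)%R.
have msqrt (u : X -> R) : measurable_fun setT u ->
    measurable_fun setT (fun x : X => Num.sqrt (u x) : R).
  move=> mu_; apply: measurableT_comp => //.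
  by apply: continuous_measurable_fun; exact: sqrt_continuous.
have mr : measurable_fun setT r by apply: measurable_funM; exact: msqrt.
have mD : measurable_fun setT D.
  by apply: measurable_funX; apply: measurable_funB; exact: msqrt.
have r0 x : (0 <= r x)%R by rewrite mulr_ge0 ?sqrtr_ge0.
have D0 x : (0 <= D x)%R by rewrite sqr_ge0.
have rE : \int[mu]_x (Num.sqrt (q x / p x) * p x)%:E = \int[mu]_x (r x)%:E.
  by apply: eq_integral => x _; rewrite sqrt_ratioM.
rewrite rE in rho1.
have addI (u v : X -> R) : measurable_fun setT u -> measurable_fun setT v ->
    (forall x, 0 <= u x)%R -> (forall x, 0 <= v x)%R ->
    \int[mu]_x (u x + v x)%:E = \int[mu]_x (u x)%:E + \int[mu]_x (v x)%:E.
  move=> mu_ mv u0 v0; under eq_integral do rewrite EFinD.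
  by apply: ge0_integralD => //; do ?[exact/measurable_EFinP] => x _; rewrite lee_fin.
have key : \int[mu]_x (D x)%:E + (\int[mu]_x (r x)%:E + \int[mu]_x (r x)%:E) = 1 + 1.
  rewrite -{1}p1 -q1 -!addI//; first last.
  - by move=> x; rewrite addr_ge0.
  - exact: measurable_funD.
  apply: eq_integral => x _; congr EFin.
  by rewrite /D /r sqrrB !sqr_sqrtr// mulr2n; ring.
have D1 : \int[mu]_x (D x)%:E = 0.
  apply/eqP; rewrite eq_le integral_ge0 ?andbT; last by move=> x _; rewrite lee_fin.
  rewrite -(@leeD2rE _ (1 + 1))// add0e -[leRHS]key leeD2l// leeD//.
pose N := [set x | p x != q x].
have mN : measurable N.
  rewrite /N -[X in measurable X]setTI.
  rewrite (_ : [set x | p x != q x] = (fun x => (p x - q x)%R) @^-1` (~` [set 0%R])).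
    by apply: (measurable_funB mp mq) => //; exact: measurableC.
  by apply/seteqP; split => x /=; rewrite -subr_eq0 => /eqP.
have muN : mu N = 0.
  have /(ae_eq_integral_abs mu measurableT) : measurable_fun setT (EFin \o D).
    exact/measurable_EFinP.
  move=> H; have [+ _] := H.
  rewrite (eq_integral (fun x => (D x)%:E)); last first.
    by move=> x _; rewrite /= ger0_norm.
  move=> /(_ D1) [M [mM M0 sub]].
  apply: (subset_measure0 mN mM) => // x Nx; apply: sub => /= h.
  move: Nx; rewrite /N/= => /eqP; apply.
  have /eqP := h Logic.I; rewrite eqe sqrf_eq0 subr_eq0 eqr_sqrt// => /eqP//.
rewrite /llr_mean.
(* The integrand vanishes outside the null set N and is at most +oo on N. *)
apply: (@le_trans _ _ (\int[mu]_x (+oo * (\1_N x)%:E))).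
  apply: le_integral_upper => x; first by rewrite mule_ge0// lee_fin.
  rewrite indicE; have [xN|xN] := boolP (x \in N).
    by rewrite mule1 leey.
  rewrite llr_diag ?mule0//; apply/eqP/negP => /negP xN'.
  by move/negP: xN; apply; rewrite inE.
rewrite ge0_integralZl//; last by apply/measurable_EFinP; exact: measurable_indic.
by rewrite integral_indic// setIT muN mule0.
Qed.

End hellinger.

(** * From the stopping statistic to likelihood ratios *)

(** Sorting the indices instead of the values exhibits streams that realize the
    m smallest values. *)
Lemma sum_order_stat (R : realType) (K m : nat) (a : 'I_K -> \bar R) :
  (m <= K)%N ->
  exists2 M : {set 'I_K}, #|M| = m &
    \sum_(i < m) order_stat a i = \sum_(k in M) a k.
Proof.
move=> mK; pose s := sort (relpre a <=%O) (enum 'I_K).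
have us : uniq s by rewrite sort_uniq enum_uniq.
have ss : size s = K by rewrite size_sort size_enum_ord.
have ut : uniq (take m s) by exact: take_uniq.
have st : size (take m s) = m by rewrite size_takel// ss.
exists [set k in take m s].
  by rewrite cardsE (card_uniqP ut).
rewrite (eq_bigl (mem (take m s))); last by move=> k; rewrite inE.
rewrite -big_uniq//= -[in RHS](map_id (take m s)) big_map.
rewrite -(big_map a xpredT id) (big_nth 0) size_map st big_mkord.
apply: eq_bigr => i _; rewrite /order_stat sort_map -/s.
by rewrite map_take nth_take.
Qed.

Lemma sqrtr_prod (R : rcfType) (I : Type) (s : seq I) (Pr : pred I) (F : I -> R) :
  (forall i, (0 <= F i)%R) ->
  Num.sqrt (\prod_(i <- s | Pr i) F i)%R = (\prod_(i <- s | Pr i) Num.sqrt (F i))%R.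
Proof.
move=> F0; elim: s => [|i s IH]; first by rewrite !big_nil sqrtr1.
by rewrite !big_cons; case: (Pr i); rewrite ?sqrtrM// IH.
Qed.

Lemma in_symdiff (T : finType) (B C : {set T}) k :
  (k \in symdiff B C) = (k \in B) (+) (k \in C).
Proof. by rewrite !inE; case: (k \in B); case: (k \in C). Qed.

Section pointwise.
Context (R : realType) (K : nat) (d : 'I_K -> measure_display)
  (X : forall k : 'I_K, measurableType (d k))
  (f : forall k : 'I_K, bool -> X k -> R)
  (Omega : Type) (obs : forall k : 'I_K, nat -> Omega -> X k).
Arguments f : clear implicits.
Hypothesis f0 : forall k i x, (0 <= f k i x)%R.

(** Likelihood ratio of the false state of stream k against its true state when
    A is the signal set; by the convention c / 0 = 0 it vanishes where the true
    density does. *)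
Definition lratio (A : {set 'I_K}) (k : 'I_K) (x : X k) : R :=
  (f k (k \notin A) x / f k (k \in A) x)%R.

Arguments lratio : clear implicits.

Lemma lratio_ge0 A k x : (0 <= lratio A k x)%R.
Proof. by rewrite divr_ge0. Qed.

Lemma llr_fin_num k (x : X k) : llr (f k true) (f k false) x \is a fin_num ->
  [/\ (0 < f k true x)%R, (0 < f k false x)%R &
    llr (f k true) (f k false) x = (ln (f k true x / f k false x))%:E].
Proof.
rewrite /llr; have [->|t0] := eqVneq (f k true x) 0%R.
  by rewrite mul0e le0_lneNy.
have tgt0 : (0 < f k true x)%R by rewrite lt_def t0 f0.
have [->|n0] := eqVneq (f k false x) 0%R.
  by rewrite inve0 gt0_muley.
have ngt0 : (0 < f k false x)%R by rewrite lt_def n0 f0.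
by rewrite inver (negPf n0) -EFinM lne_EFin// divr_gt0.
Qed.

(** One of lambda and - lambda is the logarithm of the product of the ratios.
    Finiteness of lambda guarantees that no density vanishes at any of the
    observations, since an infinite increment would make the sum infinite. *)
Lemma expR_abs_loglik A k t w : loglik f obs k t w \is a fin_num ->
  (expR (- fine `|loglik f obs k t w|) <=
   \prod_(0 <= s < t) lratio A k (obs k s w))%R.
Proof.
move=> finl.
have finx (s : 'I_t) : llr (f k true) (f k false) (obs k s w) \is a fin_num.
  move: finl; rewrite /loglik sum_fin_num => /allP; apply.
  by apply/mapP; exists s; rewrite // mem_filter /= mem_index_enum.
pose y := (\sum_(s < t) ln (f k true (obs k s w) / f k false (obs k s w)))%R.
have -> : loglik f obs k t w = y%:E.
  rewrite /loglik -sumEFin; apply: eq_bigr => s _.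
  by have [_ _ ->] := llr_fin_num (finx s).
rewrite big_mkord /lratio.
case: (k \in A) => /=.
  apply: (@le_trans _ _ (expR (- y))); first by rewrite ler_expR lerN2 ler_norm.
  rewrite /y -sumrN expR_sum; apply: ler_prod => s _; rewrite expR_ge0/=.
  have [a b _] := llr_fin_num (finx s).
  by rewrite expRN lnK ?posrE ?divr_gt0// invf_div.
apply: (@le_trans _ _ (expR y)).
  by rewrite ler_expR lerNl -normrN ler_norm.
rewrite /y expR_sum; apply: ler_prod => s _; rewrite expR_ge0/=.
have [a b _] := llr_fin_num (finx s).
by rewrite lnK ?posrE ?divr_gt0.
Qed.

(** A statistic below b makes each of the log-likelihood ratios that enter it
    finite, so observations at which a density vanishes need no separate
    treatment and no null set is discarded. *)
Lemma SI_statistic_lt A m0 b t w : (m0 <= K)%N ->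
  SI_statistic f obs m0 t w < b%:E ->
  exists2 M : {set 'I_K}, #|M| = m0 &
    (expR (- b) <= \prod_(k in M) \prod_(0 <= s < t) lratio A k (obs k s w))%R.
Proof.
move=> mK; have [M cM] := sum_order_stat (fun k => `|loglik f obs k t w|) mK.
rewrite /SI_statistic => -> Sb; exists M => //.
have finM k : k \in M -> loglik f obs k t w \is a fin_num.
  move=> kM; rewrite fin_num_abs (le_lt_trans _ (lt_trans Sb (ltry b)))//.
  rewrite (bigD1 k)//= -[leLHS]adde0 leeD2l// sume_ge0// => j _; exact: abse_ge0.
apply: (@le_trans _ _ (\prod_(k in M) expR (- fine `|loglik f obs k t w|))%R).
  rewrite -expR_sum ler_expR sumrN lerN2 -lee_fin -sumEFin ltW//.
  rewrite (le_lt_trans _ Sb)//; apply: lee_sum => k kM.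
  by rewrite fineK// abse_fin_num finM.
apply: ler_prod => k kM; rewrite expR_ge0/=.
exact/expR_abs_loglik/finM.
Qed.

End pointwise.

Arguments lratio {R K d X} f A k x.

(** * Series of nonnegative extended reals *)

Lemma nneseries_le_of_partial (R : realType) (u : nat -> \bar R) (c : \bar R) :
  (forall n, 0 <= u n) -> (forall N, \sum_(0 <= n < N) u n <= c) ->
  \sum_(0 <= n <oo) u n <= c.
Proof.
move=> u0 uc; apply: lime_le; first exact: is_cvg_nneseries.
exact: nearW.
Qed.

Lemma nneseries_ge_term (R : realType) (u : nat -> \bar R) k :
  (forall n, 0 <= u n) -> u k <= \sum_(0 <= n <oo) u n.
Proof.
move=> u0; apply: le_trans (nneseries_lim_ge k.+1 (fun n _ _ => u0 n)).
by rewrite big_nat_recr//= leeDr// sume_ge0.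
Qed.

Lemma nneseries_geometric_le (R : realType) (x : R) : (0 <= x < 1)%R ->
  \sum_(0 <= n <oo) (x ^+ n)%:E <= ((1 - x)^-1)%:E.
Proof.
move=> /andP[x0 x1]; apply: nneseries_le_of_partial => [n|N].
  by rewrite lee_fin exprn_ge0.
rewrite sumEFin lee_fin -div1r ler_pdivlMr ?subr_gt0// mulrC big_mkord.
by rewrite -opprB mulNr -subrX1 opprB gerBl exprn_ge0.
Qed.

(** * The observation model and change of measure *)

Section observation_model.
Context (R : realType) (K : nat) (d : 'I_K -> measure_display)
  (X : forall k : 'I_K, measurableType (d k))
  (mu : forall k : 'I_K, {sigma_finite_measure set (X k) -> \bar R})
  (f : forall k : 'I_K, bool -> X k -> R)
  (d' : measure_display) (Omega : measurableType d')
  (P : {set 'I_K} -> probability Omega R)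
  (obs : forall k : 'I_K, nat -> Omega -> X k).
Arguments f : clear implicits.
Hypothesis hf : forall (k : 'I_K) (i : bool), is_density (mu k) (f k i).
Hypothesis hmodel : stream_model mu f P obs.
Implicit Types (A B C F M : {set 'I_K})
  (g h : forall k : 'I_K, nat -> X k -> R).

Let mf k i : measurable_fun setT (f k i). Proof. by case: (hf k i). Qed.
Let f0 k i x : (0 <= f k i x)%R. Proof. by case: (hf k i). Qed.
Let mobs k s : measurable_fun setT (obs k s). Proof. by case: hmodel. Qed.

Lemma measurable_preimage_obs k s (C : set (X k)) :
  measurable C -> measurable (obs k s @^-1` C).
Proof. by move=> mC; rewrite -[X in measurable X]setTI; exact: mobs. Qed.

Lemma expectation_obs A k s (g : X k -> R) :
  measurable_fun setT g -> (forall x, (0 <= g x)%R) ->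
  \int[P A]_w (g (obs k s w))%:E = \int[mu k]_x (g x * f k (k \in A) x)%:E.
Proof.
move=> mg g0.
under eq_integral do rewrite -[g _]mulr1.
apply: (@integral_comp_determined _ _ _ _ _ _ _ _ _ _ id (fun=> 1%R)
  (f k (k \in A))) => //.
move=> C mC; under eq_integral do rewrite mulr1 -[\1_C _]/(\1_(obs k s @^-1` C) _).
have mpre := measurable_preimage_obs s mC.
rewrite integral_indic// setIT.
have [_ law _] := hmodel.
transitivity (\int[mu k]_(x in C) (f k (k \in A) x)%:E); first exact: law.
rewrite [LHS]integral_mkcond; apply: eq_integral => x _.
by rewrite patchE indicE; case: ifP; rewrite (mul1r, mul0r).
Qed.

Definition obs_indices (N : nat) : seq ('I_K * nat) :=
  [seq (k, s) | k <- enum 'I_K, s <- iota 0 N].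

Lemma mem_obs_indices N i : (i \in obs_indices N) = (i.2 < N)%N.
Proof.
case: i => k s; apply/allpairsP/idP => [[[k' s'] /= [_ + [_ ->]]]|sN].
  by rewrite mem_iota add0n => /andP[].
by exists (k, s); rewrite mem_enum mem_iota.
Qed.

Lemma uniq_obs_indices N : uniq (obs_indices N).
Proof.
by apply: allpairs_uniq; rewrite ?enum_uniq ?iota_uniq// => -[? ?] [? ?] _ _.
Qed.

Lemma prod_obs_indices N (F : 'I_K -> nat -> R) :
  (\prod_(i <- obs_indices N) F i.1 i.2 = \prod_k \prod_(0 <= s < N) F k s)%R.
Proof.
rewrite big_allpairs big_enum /=; apply: eq_bigr => k _.
by rewrite /index_iota subn0.
Qed.

(** A pi-system that generates the history at time t and on which independence
    computes probabilities. *)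
Definition rectangles (t : nat) : set (set Omega) :=
  [set E | exists2 C : forall k : 'I_K, nat -> set (X k),
     forall k s, measurable (C k s) &
     E = \bigcap_(i in [set` obs_indices t]) (obs i.1 i.2 @^-1` C i.1 i.2)].

Lemma rectangles_measurable t : rectangles t `<=` measurable.
Proof.
move=> _ [C mC ->]; apply: fin_bigcap_measurable => // i _.
exact: measurable_preimage_obs.
Qed.

Lemma history_rectangles t : history obs t `<=` <<s rectangles t >>.
Proof.
apply: sub_sigma_algebra2 => _ [k [s [C [st mC ->]]]].
exists (@upd_sets _ _ _ (fun _ _ => setT) (k, s) C).
  exact: measurable_upd_sets.
apply/seteqP; split => w /=; last first.
  move=> /(_ (k, s)); rewrite /= mem_obs_indices (upd_sets_in _ (i := (k, s))).
  exact.
move=> Cw i _; have [->|ne] := eqVneq i (k, s); first by rewrite upd_sets_in.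
by rewrite upd_sets_out.
Qed.

Lemma history_measurable t : history obs t `<=` measurable.
Proof.
move=> E /history_rectangles; apply: smallest_sub.
  exact: sigma_algebra_measurable.
exact: rectangles_measurable.
Qed.

(** Before time t the weighted densities under A and under B coincide, whatever
    events one restricts to; after t only the means of the weights are compared,
    because an event of the history at t does not restrict the later
    observations.  By independence both sides agree on rectangles, hence on the
    whole history. *)
Lemma change_of_measure A B t N g h : (t <= N)%N ->
  (forall k s, measurable_fun setT (g k s)) ->
  (forall k s x, (0 <= g k s x)%R) ->
  (forall k s, measurable_fun setT (h k s)) ->
  (forall k s x, (0 <= h k s x)%R) ->
  (forall k s, \int[P A]_w (g k s (obs k s w))%:E < +oo) ->
  (forall k s x, (s < t)%N ->
     g k s x * f k (k \in A) x = h k s x * f k (k \in B) x)%R ->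
  (forall k s, (t <= s)%N ->
     \int[P A]_w (g k s (obs k s w))%:E = \int[P B]_w (h k s (obs k s w))%:E) ->
  forall E, history obs t E ->
  \int[P A]_(w in E) (\prod_(i <- obs_indices N) g i.1 i.2 (obs i.1 i.2 w))%:E =
  \int[P B]_(w in E) (\prod_(i <- obs_indices N) h i.1 i.2 (obs i.1 i.2 w))%:E.
Proof.
move=> tN mg g0 mh h0 goo gh_lt gh_ge E /history_rectangles.
have [_ _ indep] := hmodel.
have fink (u : forall k : 'I_K, nat -> X k -> R) (D : {set 'I_K}) k s :
    (forall k s, measurable_fun setT (u k s)) ->
    (forall k s x, (0 <= u k s x)%R) ->
    \int[P D]_w (u k s (obs k s w))%:E < +oo ->
    \int[P D]_w (u k s (obs k s w))%:E =
    (fine (\int[P D]_w (u k s (obs k s w))%:E))%:E.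
  move=> mu_ u0 uoo; rewrite fineK// ge0_fin_numE//.
  by apply: integral_ge0 => w _; rewrite lee_fin.
have ghE k s : \int[P A]_w (g k s (obs k s w))%:E =
               \int[P B]_w (h k s (obs k s w))%:E.
  have [st|ts] := ltnP s t; last exact: gh_ge.
  by rewrite !expectation_obs//; apply: eq_integral => x _; rewrite gh_lt.
apply: eq_integral_pi_system.
- exact (@measurable_prod_obs _ _ _ _ _ _ obs mobs g (obs_indices N) mg).
- exact (@measurable_prod_obs _ _ _ _ _ _ obs mobs h (obs_indices N) mh).
- by move=> w; apply: prodr_ge0.
- by move=> w; apply: prodr_ge0.
- exact: rectangles_measurable.
- move=> _ _ [C1 mC1 ->] [C2 mC2 ->].
  exists (fun k s => C1 k s `&` C2 k s); first by move=> k s; exact: measurableI.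
  by rewrite -bigcapI.
- by exists (fun _ _ => setT) => //; rewrite bigcapT.
- rewrite (@expectation_prod _ _ _ _ _ _ _ _ mobs (indep A) _
    (fun k s => fine (\int[P A]_w (g k s (obs k s w))%:E)))//.
  + by rewrite ltry.
  + by move=> k s; exact: fink.
  + exact: uniq_obs_indices.
move=> _ [C mC ->].
(* The indicator of the rectangle is absorbed into the weights. *)
pose cut (u : forall k : 'I_K, nat -> X k -> R) k s x :=
  ((if (s < t)%N then \1_(C k s) x else 1) * u k s x : R)%R.
have mcut (u : forall k : 'I_K, nat -> X k -> R) :
    (forall k s, measurable_fun setT (u k s)) ->
    forall k s, measurable_fun setT (cut u k s).
  move=> mu_ k s; apply: measurable_funM => //.
  by case: (s < t)%N => //; exact: measurable_indic.
have cut0 (u : forall k : 'I_K, nat -> X k -> R) :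
    (forall k s x, (0 <= u k s x)%R) -> forall k s x, (0 <= cut u k s x)%R.
  by move=> u0 k s x; apply: mulr_ge0 => //; case: ifP.
have cutE (u : forall k : 'I_K, nat -> X k -> R) (D : {set 'I_K}) :
    \int[P D]_(w in \bigcap_(i in [set` obs_indices t])
      (obs i.1 i.2 @^-1` C i.1 i.2))
      (\prod_(i <- obs_indices N) u i.1 i.2 (obs i.1 i.2 w))%:E =
    \int[P D]_w (\prod_(i <- obs_indices N) cut u i.1 i.2 (obs i.1 i.2 w))%:E.
  rewrite integral_mkcond; apply: eq_integral => w _.
  rewrite big_split/= -big_mkcond/=.
  have -> : (\prod_(i <- obs_indices N | (i.2 < t)%N) \1_(C i.1 i.2) (obs i.1 i.2 w) =
    \prod_(i <- obs_indices t) \1_(C i.1 i.2) (obs i.1 i.2 w) :> R)%R.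
    rewrite -big_filter; apply: perm_big; apply: uniq_perm.
    - exact/filter_uniq/uniq_obs_indices.
    - exact: uniq_obs_indices.
    move=> i; rewrite mem_filter !mem_obs_indices andb_idr// => it.
    exact: leq_trans tN.
  rewrite prod_indic_preimage patchE indicE.
  by case: ifP; rewrite (mul1r, mul0r).
have cutoo : forall k s, \int[P A]_w (cut g k s (obs k s w))%:E < +oo.
  move=> k s; apply: le_lt_trans (goo k s).
  apply: le_integral_upper => w; rewrite lee_fin//.
  rewrite /cut; case: ifP => _; last by rewrite mul1r.
  by rewrite ler_piMl// indicE; case: (_ \in _).
have cutgh k s : \int[P A]_w (cut g k s (obs k s w))%:E =
               \int[P B]_w (cut h k s (obs k s w))%:E.
  have [st|ts] := ltnP s t; last first.
    by rewrite /cut ltnNge ts/=; under eq_integral do rewrite mul1r;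
       under [RHS]eq_integral do rewrite mul1r; exact: gh_ge.
  rewrite (expectation_obs _ _ (mcut _ mg k s) (cut0 _ g0 k s)).
  rewrite (expectation_obs _ _ (mcut _ mh k s) (cut0 _ h0 k s)).
  by apply: eq_integral => x _; rewrite -!mulrA gh_lt.
rewrite !cutE.
rewrite (@expectation_prod _ _ _ _ _ _ _ _ mobs (indep A) (cut g)
    (fun k s => fine (\int[P A]_w (cut g k s (obs k s w))%:E)))//; last 4 first.
- exact: mcut.
- exact: cut0.
- by move=> k s; apply: fink => //; [exact: mcut|exact: cut0].
- exact: uniq_obs_indices.
rewrite (@expectation_prod _ _ _ _ _ _ _ _ mobs (indep B) (cut h)
    (fun k s => fine (\int[P A]_w (cut g k s (obs k s w))%:E)))//.
- exact: mcut.
- exact: cut0.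
- by move=> k s; rewrite -cutgh; apply: fink => //; [exact: mcut|exact: cut0].
- exact: uniq_obs_indices.
Qed.

(** * Stopping times and decisions *)

Lemma history_le s t : (s <= t)%N -> history obs s `<=` history obs t.
Proof.
move=> st; apply: sub_sigma_algebra2 => _ [k [i [B [ik mB ->]]]].
by exists k, i, B; split=> //; exact: leq_trans st.
Qed.

Lemma history0 t : history obs t set0.
Proof.
rewrite /history; set G := [set E | _].
exact: (@measurable0 _ (g_sigma_algebraType G)).
Qed.

Lemma historyD t E E' :
  history obs t E -> history obs t E' -> history obs t (E `\` E').
Proof.
rewrite /history; set G := [set E | _].
exact: (@measurableD _ (g_sigma_algebraType G)).
Qed.

Lemma full_history_measurable : full_history obs `<=` measurable.
Proof.
apply: smallest_sub; first exact: sigma_algebra_measurable.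
by move=> _ [k [s [B [mB ->]]]]; exact: measurable_preimage_obs.
Qed.

Section stopped_procedure.
Variable delta : procedure R K Omega.
Hypothesis hdelta : sequential_procedures obs delta.
Let T := delta.1.
Let D := delta.2.

Definition stop_decide (t : nat) (B : {set 'I_K}) : set Omega :=
  [set w | T w = t%:R%:E /\ D w = B].

Let T_values w : T w = +oo \/ exists2 t : nat, (1 <= t)%N & T w = t%:R%:E.
Proof. by case: hdelta => -[]. Qed.

(** The definitions control {T <= t} and its intersection with {D = B} for
    t >= 1; the event at the exact time t is a difference of two of these, the
    one at t = 0 being empty because stopping times are at least 1. *)
Lemma history_stop_decide t B : history obs t (stop_decide t B).
Proof.
pose L s := [set w | D w = B] `&` [set w | T w <= s%:R%:E].
have L0 : L 0%N = set0.
  rewrite -subset0 => w [_ /=]; case: (T_values w) => [->|[s s1 ->]].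
    by rewrite leNgt ltry.
  by rewrite lee_fin ler_nat leqNgt s1.
have hL s : history obs s (L s).
  case: s => [|s]; first by rewrite L0; exact: history0.
  by case: hdelta => _ /(_ B)[_]; apply.
case: t => [|t].
  rewrite (_ : stop_decide 0%N B = set0); first exact: history0.
  rewrite -subset0 => w [] /=; case: (T_values w) => [->//|[s s1 ->]] /eqP.
  by rewrite eqe eqr_nat -leqn0 leqNgt s1.
rewrite (_ : stop_decide _ _ = L t.+1 `\` L t).
  by apply: historyD; [exact: hL|exact: history_le (hL t)].
apply/seteqP; split=> w /=.
  move=> [Tw Dw]; split; first by split => //=; rewrite Tw.
  by move=> [_ /=]; rewrite Tw lee_fin ler_nat ltnn.
move=> [[Dw Twt] nL]; split => //.
case: (T_values w) => [Tw|[s s1 Tw]]; first by move: Twt; rewrite /= Tw leNgt ltry.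
move: Twt; rewrite /= Tw lee_fin ler_nat leq_eqVlt => /predU1P[->//|st].
by case: nL; split => //=; rewrite Tw lee_fin ler_nat.
Qed.

Lemma measurable_stop_decide t B : measurable (stop_decide t B).
Proof. apply: history_measurable; exact: history_stop_decide. Qed.

Lemma measurable_decision (Q : pred {set 'I_K}) : measurable [set w | Q (D w)].
Proof.
rewrite (_ : mkset _ = \bigcup_(B in [set B | Q B]) [set w | D w = B]).
  apply: fin_bigcup_measurable => // B _.
  apply: full_history_measurable.
  by case: hdelta => _ /(_ B)[].
apply/seteqP; split=> [w Qw|w [B /= QB DwB]]; first by exists (D w).
by rewrite DwB.
Qed.

Lemma measurable_stop t : measurable [set w | T w = t%:R%:E].
Proof.
rewrite (_ : mkset _ = \bigcup_(B in setT) stop_decide t B).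
  by apply: fin_bigcup_measurable => // B _; exact: measurable_stop_decide.
by apply/seteqP; split=> [w Tw|w [B _ []]//]; exists (D w).
Qed.

Lemma measurable_stopping_time : measurable_fun setT T.
Proof.
move=> _ Y mY; rewrite setTI.
have mfin : measurable (\bigcup_(t in [set t : nat | Y t%:R%:E]) [set w | T w = t%:R%:E]).
  by apply: bigcup_measurable => t _; exact: measurable_stop.
have minf : measurable (~` \bigcup_(t : nat) [set w | T w = t%:R%:E]).
  by apply/measurableC/bigcup_measurable => t _; exact: measurable_stop.
have infE w : T w = +oo -> (~` \bigcup_(t : nat) [set w | T w = t%:R%:E]) w.
  by move=> Tw [t _ /=]; rewrite Tw.
have [Yoo|nYoo] := pselect (Y +oo).
  rewrite (_ : T @^-1` Y = (\bigcup_(t in [set t : nat | Y t%:R%:E]) [set w | T w = t%:R%:E])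
     `|` ~` \bigcup_(t : nat) [set w | T w = t%:R%:E]); first exact: measurableU.
  apply/seteqP; split=> w /=.
    move=> Yw; case: (T_values w) => [Tw|[t _ Tw]]; first by right; exact: infE.
    by left; exists t => //=; rewrite -Tw.
  move=> [[t /= Yt ->]//|nfin].
  case: (T_values w) => [->//|[t _ Tw]]; by case: nfin; exists t.
rewrite (_ : T @^-1` Y = \bigcup_(t in [set t : nat | Y t%:R%:E]) [set w | T w = t%:R%:E])//.
apply/seteqP; split=> w /=.
  move=> Yw; case: (T_values w) => [Tw|[t _ Tw]]; first by rewrite Tw in Yw.
  by exists t => //=; rewrite -Tw.
by move=> [t /= Yt ->].
Qed.

Lemma sum_stop_decide_le (C : {set 'I_K}) B (Q : pred {set 'I_K}) : Q B ->
  \sum_(0 <= t <oo) P C (stop_decide t B) <= P C [set w | Q (D w)].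
Proof.
move=> QB.
have triv : trivIset setT (fun t => stop_decide t B).
  move=> i j _ _ [w [[Ti _] [Tj _]]].
  by move: Ti; rewrite Tj => /eqP; rewrite eqe eqr_nat => /eqP.
rewrite -measure_semi_bigcup//; last 2 first.
- by move=> t; exact: measurable_stop_decide.
- by apply: bigcup_measurable => t _; exact: measurable_stop_decide.
apply: le_measure; rewrite ?inE.
- by apply: bigcup_measurable => t _; exact: measurable_stop_decide.
- exact: measurable_decision.
- by move=> w [t _ [_ DwB]] /=; rewrite DwB.
Qed.

End stopped_procedure.

(** * Likelihood ratios under a fixed signal set *)

Section fixed_signal_set.
Hypothesis hmean : forall (k : 'I_K) (i : bool),
  0 < llr_mean (mu k) (f k i) (f k (~~ i)).
Variable A : {set 'I_K}.

Local Notation r := (lratio f A).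

Let r0 k x : (0 <= r k x)%R. Proof. exact: lratio_ge0. Qed.

Lemma measurable_lratio k : measurable_fun setT (r k).
Proof.
rewrite (_ : r k = fun x => f k (k \notin A) x * (f k (k \in A) x) `^ -1)%R.
  apply: measurable_funM => //.
  by apply: (measurableT_comp (@measurable_powR R (-1))).
by apply/funext => x; rewrite powR_inv1.
Qed.

(** The Hellinger affinity int sqrt (f_0 f_1) d mu, in the form of the mean under
    P_A of the square root of the likelihood ratio. *)
Definition affinity (k : 'I_K) : R :=
  fine (\int[mu k]_x (Num.sqrt (r k x) * f k (k \in A) x)%:E).

Lemma affinityE k :
  \int[mu k]_x (Num.sqrt (r k x) * f k (k \in A) x)%:E = (affinity k)%:E.
Proof.
rewrite /affinity fineK// ge0_fin_numE; last first.
  by apply: integral_ge0 => x _; rewrite lee_fin mulr_ge0// sqrtr_ge0.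
by rewrite (lt_trans _ (ltry 1))//; exact: hellinger_lt1.
Qed.

Lemma affinity_lt1 k : (affinity k < 1)%R.
Proof. by rewrite -lte_fin -affinityE; exact: hellinger_lt1. Qed.

Lemma affinity_ge0 k : (0 <= affinity k)%R.
Proof.
by apply/fine_ge0/integral_ge0 => x _; rewrite lee_fin mulr_ge0// sqrtr_ge0.
Qed.

(** The false density may charge the zeros of the true one, where the ratio is 0:
    hence an inequality. *)
Lemma lratio_mean k : \int[mu k]_x (r k x * f k (k \in A) x)%:E <= 1.
Proof.
have [mp p0 p1] := hf k (k \notin A); rewrite -p1.
apply: le_integral_upper => x; rewrite lee_fin//= /lratio.
have [->|z] := eqVneq (f k (k \in A) x) 0%R; first by rewrite mulr0.
by rewrite divfK.
Qed.

Definition lr_prod (F : {set 'I_K}) (t : nat) (w : Omega) : R :=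
  (\prod_(k in F) \prod_(0 <= s < t) r k (obs k s w))%R.

Definition root_lr (M : {set 'I_K}) (t N : nat) (w : Omega) : R :=
  (\prod_(k in M) \prod_(t <= s < N) Num.sqrt (r k (obs k s w)))%R.

Lemma lr_prod_ge0 F t w : (0 <= lr_prod F t w)%R.
Proof. by apply: prodr_ge0 => k _; exact: prodr_ge0. Qed.

Lemma root_lr_ge0 M t N w : (0 <= root_lr M t N w)%R.
Proof. by apply: prodr_ge0 => k _; apply: prodr_ge0 => s _; exact: sqrtr_ge0. Qed.

Lemma measurable_prod_fun (F : {set 'I_K}) t N (u : forall k, X k -> R) :
  (forall k, measurable_fun setT (u k)) ->
  measurable_fun setT (fun w => \prod_(k in F) \prod_(t <= s < N) u k (obs k s w))%R.
Proof.
move=> mu_; under eq_fun do rewrite -big_filter; apply: measurable_prod => k _.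
apply: measurable_prod => s _.
exact: measurableT_comp.
Qed.

Let mr k : measurable_fun setT (r k). Proof. exact: measurable_lratio. Qed.

Let msqrt k : measurable_fun setT (fun x => Num.sqrt (r k x)).
Proof.
apply: measurableT_comp; last exact: mr.
by apply: continuous_measurable_fun; exact: sqrt_continuous.
Qed.

Lemma measurable_lr_prod F t : measurable_fun setT (lr_prod F t).
Proof. exact: (measurable_prod_fun _ _ _ mr). Qed.

Lemma measurable_root_lr M t N : measurable_fun setT (root_lr M t N).
Proof. exact: (measurable_prod_fun _ _ _ msqrt). Qed.

Definition affinity_prod (M : {set 'I_K}) : R := (\prod_(k in M) affinity k)%R.

(** The product of the ratios over F is the likelihood ratio of
    P_(symdiff A F) against P_A at time t, restricted to the observations at
    which the true densities do not vanish; each later observation contributes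
    its affinity. *)
Lemma integral_lr_prod_le (F M : {set 'I_K}) t n E : history obs t E ->
  \int[P A]_(w in E) (lr_prod F t w * root_lr M t (t + n) w)%:E
  <= (affinity_prod M ^+ n)%:E * P (symdiff A F) E.
Proof.
move=> hE.
pose g k s x : R := if (s < t)%N then (if k \in F then r k x else 1%R)
                else (if k \in M then Num.sqrt (r k x) else 1%R).
(* The indicator in h accounts for the zeros of the true density, where r
   vanishes and the density under symdiff A F need not. *)
pose h k s (x : X k) : R :=
  if (s < t)%N then
    (if k \in F then \1_(~` [set y | f k (k \in A) y = 0]) x else 1)%R
  else (if k \in M then affinity k else 1)%R.
have mg k s : measurable_fun setT (g k s).
  rewrite /g; case: (s < t)%N.
    by case: (k \in F) => //; exact: measurable_lratio.
  by case: (k \in M) => //; exact: msqrt.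
have g0 k s x : (0 <= g k s x)%R.
  by rewrite /g; case: ifP => _; case: ifP => _ //; exact: sqrtr_ge0.
have mh k s : measurable_fun setT (h k s).
  rewrite /h; case: (s < t)%N; last by case: (k \in M).
  case: (k \in F) => //; apply: measurable_indic; apply: measurableC.
  rewrite (_ : [set y | _] = setT `&` f k (k \in A) @^-1` [set 0%R]); last by rewrite setTI.
  by apply: mf => //; exact: measurable_set1.
have h0 k s x : (0 <= h k s x)%R.
  rewrite /h; case: ifP => _; case: ifP => _ //; exact: affinity_ge0.
have one D : \int[P D]_w (1%R)%:E = 1.
  by rewrite integral_cst// mul1e; exact: probability_setT.
have goo k s : \int[P A]_w (g k s (obs k s w))%:E < +oo.
  rewrite /g; case: (s < t)%N.
    case: (k \in F); last by rewrite one ltry.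
    rewrite expectation_obs//.
    exact: le_lt_trans (lratio_mean k) (ltry 1).
  case: (k \in M); last by rewrite one ltry.
  rewrite (@expectation_obs A k s (fun x => Num.sqrt (r k x)))//.
  by rewrite affinityE ltry.
have split_time (u : 'I_K -> nat -> R) : (\prod_(i <- obs_indices (t + n)) u i.1 i.2 =
    \prod_k \prod_(0 <= s < t) u k s * \prod_k \prod_(t <= s < t + n) u k s)%R.
  rewrite prod_obs_indices -big_split; apply: eq_bigr => k _.
  by rewrite -big_cat_nat//= leq_addr.
rewrite [leLHS](_ : _ = \int[P A]_(w in E)
   (\prod_(i <- obs_indices (t + n)) g i.1 i.2 (obs i.1 i.2 w))%:E); last first.
  apply: eq_integral => w _.
  rewrite /lr_prod /root_lr (split_time (fun k s => g k s (obs k s w))).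
  congr (_ * _)%:E; rewrite big_mkcond; apply: eq_bigr => k _; case: ifP => kF.
  - by apply: eq_big_nat => s /andP[_ st]; rewrite /g st kF.
  - by rewrite big_nat big1// => s /andP[_ st]; rewrite /g st kF.
  - by apply: eq_big_nat => s /andP[ts _]; rewrite /g ltnNge ts kF.
  - by rewrite big_nat big1// => s /andP[ts _]; rewrite /g ltnNge ts kF.
rewrite (@change_of_measure A (symdiff A F) t _ g h)//.
- have mE := history_measurable hE.
  apply: (@le_trans _ _ (\int[P (symdiff A F)]_(w in E) (affinity_prod M ^+ n)%:E)).
    apply: ge0_le_integral => //.
    + by move=> w _; rewrite lee_fin prodr_ge0.
    + apply/measurable_EFinP/measurable_funTS.
      exact: (@measurable_prod_obs _ _ _ _ _ _ obs mobs h _ mh).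
    + move=> w _; rewrite lee_fin (split_time (fun k s => h k s (obs k s w))).
      rewrite -[leRHS]mul1r.
      apply: ler_pM; do ?by rewrite ?prodr_ge0// => k _; rewrite prodr_ge0.
        apply: prodr_ile1 => k _; rewrite prodr_ge0//= big_nat.
        apply: prodr_ile1 => s /andP[_ st]; rewrite h0 /h st/=.
        by case: ifP => // _; rewrite indicE; case: (_ \in _).
      rewrite /affinity_prod -prodrXl [leRHS]big_mkcond; apply: ler_prod => k _.
      rewrite prodr_ge0//= big_nat (eq_bigr (fun=> if k \in M then affinity k else 1%R)).
        by rewrite -big_nat prodr_const_nat addKn; case: ifP => //; rewrite expr1n.
      by move=> s /andP[ts _]; rewrite /h ltnNge ts.
  by rewrite integral_cst.
- exact: leq_addr.
- move=> k s x st; rewrite /g /h st in_symdiff.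
  case: (k \in F); last by rewrite addbF.
  rewrite addbT indicE /lratio; have [z|nz] := eqVneq (f k (k \in A) x) 0%R.
    by rewrite z mulr0 memNset ?mul0r//; exact.
  by rewrite divfK// mem_set ?mul1r//; exact/eqP.
- move=> k s ts; rewrite /g /h ltnNge ts/=; case: (k \in M); last by rewrite !one.
  rewrite (@expectation_obs A k s (fun x => Num.sqrt (r k x)))//.
  rewrite affinityE integral_cst// -[LHS]mule1; congr (_ * _).
  exact/esym/probability_setT.
Qed.

(** The inequality 2 u v <= u^2 + v^2 with u^2 = exp b * lr_prod F t and
    v^2 = lr_prod (M minus F) t.  The factor exp b goes to F only: F will be
    chosen so that alpha compensates it. *)
Lemma root_lr_split (F M : {set 'I_K}) b t n w : F \subset M ->
  (expR (b / 2) * root_lr M 0 (t + n) w <=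
   2^-1 * (expR b * (lr_prod F t w * root_lr M t (t + n) w)
           + lr_prod (M :\: F) t w * root_lr M t (t + n) w))%R.
Proof.
move=> FM; have pr0 k N : (0 <= \prod_(0 <= s < N) r k (obs k s w))%R.
  exact: prodr_ge0.
have -> : root_lr M 0 (t + n) w = (Num.sqrt (lr_prod F t w) *
    Num.sqrt (lr_prod (M :\: F) t w) * root_lr M t (t + n) w)%R.
  rewrite /lr_prod !sqrtr_prod//.
  under eq_bigr do rewrite sqrtr_prod//.
  under [X in (_ * X * _)%R]eq_bigr do rewrite sqrtr_prod//.
  rewrite -{1}(finset.setIidPr FM) -big_setID/= -big_split; apply: eq_bigr => k _.
  by rewrite -big_cat_nat//= leq_addr.
have -> : expR b = (expR (b / 2) ^+ 2)%R.
  by rewrite -expRM_natl mulrC divfK.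
set u := expR _; set v := Num.sqrt _; set z := Num.sqrt _.
rewrite -[in leRHS](sqr_sqrtr (lr_prod_ge0 F t w)) -/v.
rewrite -[in leRHS](sqr_sqrtr (lr_prod_ge0 (M :\: F) t w)) -/z.
have tail0 := root_lr_ge0 M t (t + n) w.
have := mulr_ge0 (sqr_ge0 (u * v - z)%R) tail0.
set y := root_lr _ _ _ _ => h; rewrite -subr_ge0.
by clearbody u v z y; lra.
Qed.

Lemma integral_root_lr_le (F M : {set 'I_K}) b t n E : F \subset M ->
  history obs t E ->
  \int[P A]_(w in E) (expR (b / 2) * root_lr M 0 (t + n) w)%:E <=
  (affinity_prod M ^+ n)%:E *
    ((2^-1)%:E * ((expR b)%:E * P (symdiff A F) E + P (symdiff A (M :\: F)) E)).
Proof.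
move=> FM hE.
have mE := history_measurable hE.
have mpt G : measurable_fun E (fun w => (lr_prod G t w * root_lr M t (t + n) w)%:E).
  apply/measurable_EFinP/measurable_funTS/measurable_funM.
    exact: measurable_lr_prod.
  exact: measurable_root_lr.
have pt0 G w : (0 <= lr_prod G t w * root_lr M t (t + n) w)%R.
  by rewrite mulr_ge0 ?lr_prod_ge0 ?root_lr_ge0.
apply: (@le_trans _ _ (\int[P A]_(w in E) ((2^-1)%:E *
   ((expR b)%:E * (lr_prod F t w * root_lr M t (t + n) w)%:E +
   (lr_prod (M :\: F) t w * root_lr M t (t + n) w)%:E)))).
  apply: ge0_le_integral => //.
  - by move=> w _; rewrite lee_fin mulr_ge0 ?expR_ge0 ?root_lr_ge0.
  - apply/measurable_EFinP/measurable_funTS/measurable_funM => //.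
    exact: measurable_root_lr.
  - apply: measurable_funeM; apply: emeasurable_funD => //.
    exact: measurable_funeM.
  - by move=> w _; rewrite -!EFinM lee_fin root_lr_split.
rewrite ge0_integralZl//; last 2 first.
  - by apply: emeasurable_funD => //; exact: measurable_funeM.
  - by move=> w _; rewrite adde_ge0 ?mule_ge0 ?lee_fin ?expR_ge0.
rewrite muleCA lee_wpmul2l ?lee_fin ?invr_ge0//.
rewrite ge0_integralD//; last 3 first.
  - by move=> w _; rewrite mule_ge0 ?lee_fin ?expR_ge0.
  - exact: measurable_funeM.
  - by move=> w _; rewrite lee_fin.
rewrite ge0_integralZl ?lee_fin ?expR_ge0//; last first.
  by move=> w _; rewrite lee_fin.
have eP0 : 0 <= (expR b)%:E * P (symdiff A F) E by rewrite mule_ge0 ?lee_fin ?expR_ge0.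
rewrite (ge0_muleDr _ eP0) ?measure_ge0// muleCA; apply: leeD.
  rewrite lee_wpmul2l ?lee_fin ?expR_ge0//.
  exact: integral_lr_prod_le.
exact: integral_lr_prod_le.
Qed.

(** * Expected time of the rule against a competing procedure *)

(** From time t on, the rule waits at most one unit of time for each n at which
    its statistic is below b, and then the n-th term of the series is at least
    1.  If the statistic stays below b forever, the series diverges. *)
Lemma SI_time_le_series m0 b t w : (m0 <= K)%N -> (1 <= t)%N ->
  SI_time f obs m0 b w <= t%:R%:E +
    \sum_(M : {set 'I_K} | #|M| == m0)
       \sum_(0 <= n <oo) (expR (b / 2) * root_lr M 0 (t + n) w)%:E.
Proof.
move=> m0K t1.
pose v M n : R := (expR (b / 2) * root_lr M 0 (t + n) w)%R.
pose u n := \sum_(M : {set 'I_K} | #|M| == m0) (v M n)%:E.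
have v0 M n : 0 <= (v M n)%:E by rewrite lee_fin mulr_ge0 ?expR_ge0 ?root_lr_ge0.
have u0 n : 0 <= u n by apply: sume_ge0.
rewrite -[X in _ + X]nneseries_sum; last by move=> M n _; exact: v0.
have u1 n : SI_statistic f obs m0 (t + n) w < b%:E -> 1 <= u n.
  move=> /(SI_statistic_lt f0 A m0K)[M /eqP cM le_prod].
  rewrite /u (bigD1 M)//=; apply: (@le_trans _ _ (v M n)%:E); last first.
    by rewrite leeDl// sume_ge0.
  rewrite lee_fin /v /root_lr.
  have pr0 k N : (0 <= \prod_(0 <= s < N) lratio f A k (obs k s w))%R.
    by apply: prodr_ge0 => s _; exact: lratio_ge0.
  have -> : (\prod_(k in M) \prod_(0 <= s < t + n) Num.sqrt (lratio f A k (obs k s w)) =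
    Num.sqrt (\prod_(k in M) \prod_(0 <= s < t + n) lratio f A k (obs k s w)))%R.
    rewrite sqrtr_prod//; apply: eq_bigr => k _.
    by rewrite sqrtr_prod// => s; exact: lratio_ge0.
  have -> : expR (b / 2) = Num.sqrt (expR b).
    have two_neq0 : (2 != 0 :> R)%R by rewrite pnatr_eq0.
    rewrite -[in RHS](divfK two_neq0 b).
    by rewrite expRM_natr sqrtr_sqr ger0_norm ?expR_ge0.
  rewrite -sqrtrM ?expR_ge0// -[leLHS]sqrtr1 ler_wsqrtr//.
  by rewrite -[leLHS](expRxMexpNx_1 b) ler_wpM2l ?expR_ge0.
have stop n : b%:E <= SI_statistic f obs m0 (t + n) w ->
    SI_time f obs m0 b w <= (t + n)%:R%:E.
  move=> bS; apply: ereal_inf_lbound; exists (t + n)%N => //; split => //.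
  exact: leq_trans (leq_addr _ _).
have count N : (forall n, (n < N)%N -> SI_statistic f obs m0 (t + n) w < b%:E) ->
    N%:R%:E <= \sum_(0 <= n <oo) u n.
  move=> lt_b; apply: le_trans (nneseries_lim_ge N (fun n _ _ => u0 n)).
  elim: N lt_b => [|N IH] lt_b; first by rewrite big_geq.
  rewrite big_nat_recr//= -natr1 EFinD leeD ?u1 ?lt_b//.
  by apply: IH => n nN; apply: lt_b; exact: leqW.
have [[n bS]|never] := pselect (exists n, b%:E <= SI_statistic f obs m0 (t + n) w).
  have ex : exists n, `[< b%:E <= SI_statistic f obs m0 (t + n) w >].
    by exists n; exact/asboolP.
  case: (ex_minnP ex) => N /asboolP bSN minN.
  apply: le_trans (stop N bSN) _; rewrite natrD EFinD leeD2l// count// => i iN.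
  by rewrite ltNge; apply/negP => /asboolP /minN; rewrite leqNgt iN.
suff -> : \sum_(0 <= n <oo) u n = +oo by rewrite addey// leey.
apply/eqyP => a a0.
apply: (@le_trans _ _ (Num.Def.archi_bound a)%:R%:E).
  by rewrite lee_fin ltW// archi_boundP// ltW.
apply: count => n _; rewrite ltNge; apply/negP => bS; apply: never; by exists n.
Qed.

Lemma affinity_prod_itv M : (0 < #|M|)%N -> (0 <= affinity_prod M < 1)%R.
Proof.
move=> /card_gt0P[k kM]; rewrite prodr_ge0//=; last first.
  by move=> j _; exact: affinity_ge0.
rewrite /affinity_prod (bigD1 k)//=; apply: le_lt_trans (affinity_lt1 k).
rewrite ler_piMr ?affinity_ge0//; apply: prodr_ile1 => j _.
by rewrite affinity_ge0//= ltW// affinity_lt1.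
Qed.

(** One term for each set M of m0 streams that may delay the rule and each
    decision B of the competing procedure; the first factor sums the geometric
    series, the second comes from 2 u v <= u^2 + v^2. *)
Definition delay_const (m0 : nat) : R :=
  (\sum_(M : {set 'I_K} | #|M| == m0) \sum_(B : {set 'I_K})
     (1 - affinity_prod M)^-1 * 2^-1)%R.

Section competing_procedure.
Variables (m0 : nat) (delta : procedure R K Omega).
Hypothesis hm0 : (1 <= m0 <= K)%N.
Hypothesis hdelta : sequential_procedures obs delta.

(** Bound on the delay of the rule at the n-th observation after time t, due to
    the streams of M, when the competing procedure stops at t and declares
    B. *)
Let excess b M B t n w : R :=
  (\1_(stop_decide delta t B) w * (expR (b / 2) * root_lr M 0 (t + n) w))%R.

Let excess_ge0 b M B t n w : (0 <= excess b M B t n w)%R.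
Proof. by rewrite mulr_ge0// mulr_ge0 ?expR_ge0// root_lr_ge0. Qed.

Let measurable_excess b M B t n : measurable_fun setT (excess b M B t n).
Proof.
apply: measurable_funM.
  exact/measurable_indic/(measurable_stop_decide hdelta).
by apply: measurable_funM => //; exact: measurable_root_lr.
Qed.

Let time_excess b M B w : \bar R :=
  \sum_(0 <= t <oo) \sum_(0 <= n <oo) (excess b M B t n w)%:E.

Let time_excess_ge0 b M B w : 0 <= time_excess b M B w.
Proof. by apply: nneseries_ge0 => t _ _; apply: nneseries_ge0 => n _ _; rewrite lee_fin. Qed.

Let measurable_inner b M B t :
  measurable_fun setT (fun w => \sum_(0 <= n <oo) (excess b M B t n w)%:E).
Proof.
apply: ge0_emeasurable_sum => [n w _ _|n _]; first by rewrite lee_fin.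
exact/measurable_EFinP.
Qed.

Let measurable_time_excess b M B : measurable_fun setT (time_excess b M B).
Proof.
apply: ge0_emeasurable_sum => [t w _ _|t _]; last exact: measurable_inner.
by apply: nneseries_ge0 => n _ _; rewrite lee_fin.
Qed.

Lemma SI_time_le_excess b w : SI_time f obs m0 b w <=
  delta.1 w + \sum_(M : {set 'I_K} | #|M| == m0) \sum_(B : {set 'I_K}) time_excess b M B w.
Proof.
have [m1 mK] := andP hm0.
have s0 : 0 <= \sum_(M : {set 'I_K} | #|M| == m0) \sum_(B : {set 'I_K}) time_excess b M B w.
  by apply: sume_ge0 => M _; apply: sume_ge0 => B _.
case: hdelta => -[/(_ w) Tw _] _; case: Tw => [->|[t t1 Tw]].
  by rewrite addye ?leey// gt_eqF// (lt_le_trans _ s0).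
rewrite Tw; apply: le_trans (SI_time_le_series b w mK t1) _.
rewrite leeD2l//; apply: lee_sum => M _.
rewrite (bigD1 (delta.2 w))//= -[leLHS]adde0 leeD ?sume_ge0//.
have inner0 s : 0 <= \sum_(0 <= n <oo) (excess b M (delta.2 w) s n w)%:E.
  by apply: nneseries_ge0 => n _ _; rewrite lee_fin.
apply: le_trans (nneseries_ge_term t inner0).
apply: lee_nneseries => [n _ _|n _].
  by rewrite lee_fin mulr_ge0 ?expR_ge0// root_lr_ge0.
by rewrite lee_fin /excess indicE mem_set ?mul1r.
Qed.

(** The false signal set under which declaring B is an error on all of M: flip
    the streams of M that B gets right under A. *)
Lemma decision_error_subset (M B : {set 'I_K}) :
  M \subset symdiff B (symdiff A (M :\: symdiff B A)).
Proof.
apply/fintype.subsetP => k kM.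
rewrite !in_symdiff finset.in_setD in_symdiff kM andbT.
by case: (k \in A); case: (k \in B).
Qed.

(** The factor exp b is paired with the law under which declaring B is an error
    of size at least m0, so it meets the bound alpha; the other law only needs
    the bound 1. *)
Lemma integral_time_excess_le b M B alpha : #|M| = m0 ->
  (forall C, P C [set w | (m0 <= #|symdiff (delta.2 w) C|)%N] <= alpha%:E) ->
  \int[P A]_w time_excess b M B w <=
    ((1 - affinity_prod M)^-1 * 2^-1 * (expR b * alpha + 1))%:E.
Proof.
move=> cM err; have [m1 mK] := andP hm0.
have M0 : (0 < #|M|)%N by rewrite cM.
have /andP[q0 q1] := affinity_prod_itv M0; set q := affinity_prod M in q0 q1 *.
have q1' : (0 <= (1 - q)^-1)%R by rewrite invr_ge0 subr_ge0 ltW.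
pose F := M :\: symdiff B A.
pose C1 := symdiff A F; pose C2 := symdiff A (M :\: F).
pose c t := (2^-1)%:E * ((expR b)%:E * P C1 (stop_decide delta t B) +
                         P C2 (stop_decide delta t B)).
have c0 t : 0 <= c t.
  by rewrite mule_ge0 ?lee_fin// adde_ge0// mule_ge0// lee_fin expR_ge0.
rewrite integral_nneseries//; last first.
  by move=> t w _; apply: nneseries_ge0 => n _ _; rewrite lee_fin.
apply: (@le_trans _ _ (\sum_(0 <= t <oo) ((1 - q)^-1)%:E * c t)).
  apply: lee_nneseries => [t _ _|t _].
    apply: integral_ge0 => w _.
    by apply: nneseries_ge0 => n _ _; rewrite lee_fin.
  rewrite integral_nneseries//; last 2 first.
  - by move=> n; exact/measurable_EFinP.
  - by move=> n w _; rewrite lee_fin.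
  apply: (@le_trans _ _ (\sum_(0 <= n <oo) ((q ^+ n)%:E * c t))).
    apply: lee_nneseries => [n _ _|n _].
      by apply: integral_ge0 => w _; rewrite lee_fin.
    have hE := @history_stop_decide _ hdelta t B.
    have FM : F \subset M by exact: subsetDl.
    apply: le_trans (integral_root_lr_le b n FM hE).
    rewrite [leRHS]integral_mkcond le_eqVlt; apply/orP; left; apply/eqP.
    apply: eq_integral => w _; rewrite patchE /excess indicE.
    by case: ifP => _; rewrite (mul1r, mul0r).
  apply: nneseries_le_of_partial => [n|N].
    by rewrite mule_ge0// lee_fin exprn_ge0.
  rewrite -ge0_sume_distrl; last by move=> n _; rewrite lee_fin exprn_ge0.
  rewrite lee_wpmul2r//; apply: le_trans (@nneseries_geometric_le _ q _).
    by apply: nneseries_lim_ge => n _ _; rewrite lee_fin exprn_ge0.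
  by rewrite q0 q1.
rewrite nneseriesZl// -mulrA EFinM lee_wpmul2l ?lee_fin//.
rewrite nneseriesZl; last first.
  by move=> t _; rewrite adde_ge0// mule_ge0// lee_fin expR_ge0.
rewrite EFinM lee_wpmul2l ?lee_fin//.
rewrite nneseriesD//; last by move=> t _ _; rewrite mule_ge0// lee_fin expR_ge0.
rewrite nneseriesZl// EFinD EFinM leeD//.
  rewrite lee_wpmul2l ?lee_fin ?expR_ge0//.
  have QB : (m0 <= #|symdiff B C1|)%N.
    by rewrite -cM; exact/subset_leq_card/decision_error_subset.
  apply: le_trans (err C1).
  exact: (@sum_stop_decide_le _ hdelta C1 B
    (fun B' => m0 <= #|symdiff B' C1|)%N).
apply: le_trans (@sum_stop_decide_le _ hdelta C2 B xpredT _) _ => //.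
by apply: probability_le1; exact: (measurable_decision hdelta xpredT).
Qed.

(** Uniform comparison of the rule with any procedure of error alpha: with
    b = b_alpha the product expR b * alpha is a constant. *)
Lemma expected_SI_time_le b alpha :
  (forall C, P C [set w | (m0 <= #|symdiff (delta.2 w) C|)%N] <= alpha%:E) ->
  \int[P A]_w SI_time f obs m0 b w <=
  \int[P A]_w delta.1 w + (delay_const m0 * (expR b * alpha + 1))%:E.
Proof.
move=> err.
have T0 w : 0 <= delta.1 w.
  case: hdelta => -[/(_ w) + _] _ => -[->//|[t _ ->]].
  by rewrite lee_fin.
have s0 w : 0 <= \sum_(M : {set 'I_K} | #|M| == m0) \sum_(B : {set 'I_K}) time_excess b M B w.
  by apply: sume_ge0 => M _; apply: sume_ge0 => B _.
apply: le_trans (le_integral_upper _ _ (SI_time_le_excess b)) _.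
  by move=> w; rewrite adde_ge0.
rewrite ge0_integralD//; last 2 first.
- exact: (measurable_stopping_time hdelta).
- under eq_fun do rewrite -big_filter.
  apply: emeasurable_sum => M; apply: emeasurable_sum => B.
  exact: measurable_time_excess.
rewrite leeD2l//.
under eq_integral do rewrite -big_filter.
rewrite ge0_integral_sum//; last 2 first.
- by move=> M; apply: emeasurable_sum => B; exact: measurable_time_excess.
- by move=> M w _; apply: sume_ge0 => B _.
rewrite big_filter /delay_const mulr_suml -sumEFin; apply: lee_sum => M /eqP cM.
rewrite ge0_integral_sum// mulr_suml -sumEFin; apply: lee_sum => B _.
exact: integral_time_excess_le.
Qed.

End competing_procedure.

End fixed_signal_set.

End observation_model.

(** * Optimality *)

(** Its error probabilities are at most 1 and its expected time is 1, which is
    enough to bound the expected time of the rule by a finite number. *)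
Lemma one_sample_procedure (R : realType) (K : nat)
    (d : 'I_K -> measure_display) (X : forall k, measurableType (d k))
    (d' : measure_display) (Omega : measurableType d')
    (obs : forall k : 'I_K, nat -> Omega -> X k) :
  @sequential_procedures R K d X Omega obs (fun=> 1%:E, fun=> finset.set0).
Proof.
have const_in (G : set (set Omega)) (Q : Prop) : <<s G >> [set w | Q].
  have [q|nq] := pselect Q.
    rewrite (_ : mkset _ = setT).
      exact: (@measurableT _ (g_sigma_algebraType G)).
    by apply/seteqP; split.
  rewrite (_ : mkset _ = set0).
    exact: (@measurable0 _ (g_sigma_algebraType G)).
  by apply/seteqP; split.
split; first split => [w|t t1].
- by right; exists 1%N.
- exact: (const_in _ (1 <= t%:R%:E)).
move=> B; split=> [|t t1]; first exact: (const_in _ (finset.set0 = B)).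
exact: (const_in _ (finset.set0 = B /\ 1 <= t%:R%:E)).
Qed.

Lemma expR_SI_threshold (R : realType) (K m0 : nat) (alpha : R) :
  (m0 <= K)%N -> (0 < alpha < 1)%R ->
  (expR (SI_threshold K m0 alpha) * alpha = 'C(K, m0)%:R)%R.
Proof.
move=> mK /andP[a0 a1]; rewrite /SI_threshold ltr0_norm ?ln_lt0 ?a0//.
rewrite expRD expRN !lnK ?posrE ?ltr0n ?bin_gt0//.
by rewrite mulrAC mulVf ?mul1r// gt_eqF.
Qed.

Theorem theorem3 (R : realType) (K m0 : nat) (hK : (2 <= K)%N)
    (hm0 : (1 <= m0 <= K)%N)
    (d : 'I_K -> measure_display) (X : forall k : 'I_K, measurableType (d k))
    (mu : forall k : 'I_K, {sigma_finite_measure set (X k) -> \bar R})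
    (f : forall k : 'I_K, bool -> X k -> R)
    (hf : forall (k : 'I_K) (i : bool), is_density (mu k) (f k i))
    (d' : measure_display) (Omega : measurableType d')
    (P : {set 'I_K} -> probability Omega R)
    (obs : forall k : 'I_K, nat -> Omega -> X k)
    (hmodel : stream_model mu f P obs)
    (hmean : forall (k : 'I_K) (i : bool),
       0 < llr_mean (mu k) (f k i) (f k (~~ i)))
    (hmoment : forall (k : 'I_K) (i : bool),
       llr_second_moment (mu k) (f k i) (f k (~~ i)) < +oo) :
  second_order_optimal P
    (fun alpha : R => sum_intersection f obs m0 (SI_threshold K m0 alpha))
    (fun alpha : R => gmr_class P obs m0 alpha).
Proof.
move=> A; have [m1 mK] := andP hm0.
pose C := (@delay_const R K d X mu f A m0 * ('C(K, m0)%:R + 1))%R.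
apply: (@le_lt_trans _ _ C%:E); last exact: ltry.
rewrite limf_esupE.
apply: (@le_trans _ _ (ereal_sup ((fun alpha : R =>
   (\int[P A]_w SI_time f obs m0 (SI_threshold K m0 alpha) w
    - min_expected_time (P A) (gmr_class P obs m0 alpha))%dE) @` [set a | 0 < a < 1]%R))).
  apply: ereal_inf_lbound; exists [set a | 0 < a < 1]%R => //.
  apply: filterS2 (nbhs_right_gt 0%R) (nbhs_right_lt (ltr01 : (0 < 1 :> R)%R)).
  by move=> a a0 a1; apply/andP.
apply: ge_ereal_sup => _ [alpha alpha01 <-].
set x := (\int[P A]_w _).
have x0 : 0 <= x.
  apply: integral_ge0 => w _; apply: le_ereal_inf_tmp => _ [t _ <-].
  by rewrite lee_fin.
have xfin : x \is a fin_num.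
  rewrite ge0_fin_numE//.
  have h := @expected_SI_time_le _ _ _ _ _ _ _ _ _ _ hf hmodel hmean A m0 _ hm0
    (one_sample_procedure R obs) (SI_threshold K m0 alpha) 1%R.
  apply: le_lt_trans (h _) _.
    move=> B; apply: probability_le1.
    exact: (measurable_decision hmodel (one_sample_procedure R obs)
      (fun B' => m0 <= #|symdiff B' B|)%N).
  rewrite integral_cst//= mul1e.
  rewrite [X in X + _](_ : _ = 1) -?EFinD ?ltry//.
  exact: probability_setT.
have xle y : [set \int[P A]_w delta.1 w | delta in gmr_class P obs m0 alpha] y ->
    x - C%:E <= y.
  move=> [delta [hdelta err] <-].
  rewrite leeBlDr//.
  have := expected_SI_time_le hf hmodel hmean A hm0 hdelta (SI_threshold K m0 alpha) err.
  by rewrite expR_SI_threshold.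
(* Where the minimal time is infinite, the difference is -oo because x is
   finite. *)
have : x - C%:E <= min_expected_time (P A) (gmr_class P obs m0 alpha).
  exact: le_ereal_inf_tmp.
case: min_expected_time => [y| |]; rewrite -(fineK xfin) /=.
- rewrite -!EFinB lee_fin => h.
  by rewrite -[leLHS]/((fine x - y)%:E) lee_fin lerBlDl -lerBlDr.
- by move=> _; rewrite leNye.
- by rewrite leeNy_eq.
Qed.
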